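(* Let $N\ge 3$ and $k\in\{1,\dots,N\}$. The $k$-closed-path $[k],[2k],\dots,[Nk],[k]$ in the interaction graph on $\{1,\dots,N\}$ is a Hamiltonian cycle if and only if $\gcd(k,N)=1$.
   Context: $[i]$ denotes the residue of $i$ modulo $N$, with representative taken in $\{1,\dots,N\}$. The interaction graph is the complete graph on the vertex set $\{1,\dots,N\}$ (each edge $\{i,j\}$ oriented from the smaller to the larger vertex; closed paths may traverse edges in either direction). The sequence of vertices $[k],[2k],\dots,[Nk],[k]$ is called the $k$-closed-path. It is a cycle if it does not repeat vertices (apart from returning to its starting vertex), and a Hamiltonian cycle if moreover each vertex of the graph is visited exactly once, i.e. each element of $\{1,\dots,N\}$ appears exactly once among $[k],[2k],\dots,[Nk]$. *)

(* Defs.v *)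
From mathcomp Require Import all_boot.

Set Implicit Arguments.
Unset Strict Implicit.
Unset Printing Implicit Defensive.

Section ClosedPaths.
Variables (T : eqType) (V : seq T) (e : rel T).
Implicit Type w : seq T.

(* A closed path is written with its starting vertex repeated at the end, so
   [behead w] lists the visited vertices with the starting vertex counted once
   (upon return). *)
Definition is_closed_path w : Prop :=
  exists x p, w = x :: rcons p x /\ path e x (rcons p x).

Definition is_cycle w : Prop := is_closed_path w /\ uniq (behead w).

Definition is_hamiltonian_cycle w : Prop :=
  is_cycle w /\ forall v, v \in V -> count_mem v (behead w) = 1.

End ClosedPaths.

Definition vertices (N : nat) : seq nat := iota 1 N.

Definition oriented_edge (N : nat) : rel nat :=
  fun i j => [&& i \in vertices N, j \in vertices N & i < j].

(* Paths may traverse an edge in either direction. *)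
Definition interaction_graph (N : nat) : rel nat :=
  fun i j => oriented_edge N i j || oriented_edge N j i.

(* The residue of i modulo N with representative in {1, ..., N} (for N > 0),
   see residue_mem and residue_mod. *)
Definition residue (N i : nat) : nat := if N %| i then N else i %% N.

Definition k_closed_path (N k : nat) : seq nat :=
  rcons [seq residue N (i * k) | i <- iota 1 N] (residue N k).

Lemma residue_mem (N i : nat) : 0 < N -> residue N i \in vertices N.
Proof.
move=> N0; rewrite mem_iota add1n ltnS /residue.
case: ifPn => [_|]; first by rewrite N0 leqnn.
by rewrite /dvdn -lt0n => ->; rewrite ltnW // ltn_pmod.
Qed.

Lemma residue_mod (N i : nat) : residue N i = i %[mod N].
Proof.
rewrite /residue; case: ifPn => [/eqP ->|_]; first by rewrite modnn.
by rewrite modn_mod.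
Qed.

Lemma interaction_graphE (N i j : nat) :
  interaction_graph N i j =
  [&& i \in vertices N, j \in vertices N & i != j].
Proof.
rewrite /interaction_graph /oriented_edge neq_ltn.
by case: (i \in _); case: (j \in _).
Qed.

(* Main.v *)
(* If the path is Hamiltonian it visits the vertex 1, so k is invertible modulo
   N. Conversely, if k is coprime to N, multiplication by k is injective modulo
   N, so the N vertices [k], ..., [Nk] are distinct and exhaust {1, ..., N};
   consecutive ones are adjacent because N does not divide k. *)
Require Import Defs.
From mathcomp Require Import all_boot.

Lemma residue_eq_mod (N i j : nat) :
  residue N i = residue N j -> i = j %[mod N].
Proof. by move=> eq_ij; rewrite -(residue_mod N i) eq_ij residue_mod. Qed.

Lemma residueDMl (N i j : nat) : residue N (i + N * j) = residue N i.
Proof. by rewrite /residue addnC mulnC modnMDl dvdn_addr ?dvdn_mull. Qed.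

(** The closing vertex [[k]] equals [[(N+1)k]], so the whole closed path is a single progression,
    ready for induction. *)
Lemma k_closed_pathE (N k : nat) :
  k_closed_path N k = [seq residue N (i * k) | i <- iota 1 N.+1].
Proof.
rewrite /k_closed_path -(addn1 N) iotaD map_cat cats1 add1n.
by rewrite mulSn residueDMl.
Qed.

(** Both ends of the closed path are [[k]], so dropping the first only rotates the list. *)
Lemma perm_behead_k_closed_path (N k : nat) : 0 < N ->
  perm_eq (behead (k_closed_path N k)) [seq residue N (i * k) | i <- iota 1 N].
Proof. by case: N => // N _; rewrite /k_closed_path /= mul1n perm_rcons. Qed.

Lemma residue_mul_inj (N k : nat) : coprime k N ->
  {in iota 1 N &, injective (fun i => residue N (i * k))}.
Proof.
move=> cop i j; rewrite !mem_iota !add1n !ltnS => Hi Hj.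
move=> /residue_eq_mod eq_ij.
wlog le_ij : i j Hi Hj eq_ij / i <= j.
  by move=> W; case/orP: (leq_total i j) => le; [|symmetry]; apply: W.
have /andP [i0 _] := Hi; have /andP [_ jN] := Hj.
have /eqP := esym eq_ij; rewrite eqn_mod_dvd ?leq_mul2r ?le_ij ?orbT //.
rewrite -mulnBl Gauss_dvdl 1?coprime_sym // => dvd_ij.
apply/eqP; rewrite eqn_leq le_ij /= -subn_eq0.
apply: contraLR dvd_ij; rewrite -lt0n => ?; rewrite gtnNdvd //.
(* Indices start at 1, so [j - i < j <= N]; a positive difference is then too small to be a multiple
   of [N]. *)
by apply: leq_trans jN; rewrite ltn_subrL i0 (leq_trans i0).
Qed.

(** Equal consecutive vertices would make [N] divide their difference [(i+1)k - ik = k]. *)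
Lemma interaction_graph_residue_mulS (N k i : nat) : 0 < N -> ~~ (N %| k) ->
  interaction_graph N (residue N (i * k)) (residue N (i.+1 * k)).
Proof.
move=> N0 ndvd; rewrite interaction_graphE !residue_mem //=.
apply: contra ndvd => /eqP /residue_eq_mod /esym /eqP.
by rewrite eqn_mod_dvd ?leq_mul2r ?leqnSn ?orbT // mulSn addnK.
Qed.

Lemma path_residue_mul (N k m n : nat) : 0 < N -> ~~ (N %| k) ->
  path (interaction_graph N) (residue N (m * k))
       [seq residue N (i * k) | i <- iota m.+1 n].
Proof.
move=> N0 ndvd; elim: n m => //= n IHn m.
by rewrite interaction_graph_residue_mulS //=.
Qed.

Lemma is_closed_path_k_closed_path (N k : nat) : 0 < N -> ~~ (N %| k) ->
  is_closed_path (interaction_graph N) (k_closed_path N k).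
Proof.
move=> N0 ndvd.
exists (residue N k), [seq residue N (i * k) | i <- iota 2 N.-1].
have Ew : k_closed_path N k = residue N k ::
    rcons [seq residue N (i * k) | i <- iota 2 N.-1] (residue N k).
  by rewrite /k_closed_path -{2}(prednK N0) /= mul1n.
(* Comparing the two forms of the closed path identifies its tail with the progression over indices
   2 to [N+1]. *)
split=> //; move: Ew; rewrite k_closed_pathE map_cons => -[_ <-].
by rewrite -{1}(mul1n k) path_residue_mul.
Qed.

Theorem proposition1 (N k : nat) (hN : 3 <= N) (hk : 1 <= k <= N) :
  is_hamiltonian_cycle (vertices N) (interaction_graph N) (k_closed_path N k)
  <-> gcdn k N = 1.
Proof.
have N0 : 0 < N by apply: leq_trans hN.
have perm_w := perm_behead_k_closed_path N k N0.
split=> [[_ visits]|/eqP cop].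
  have : 1 \in behead (k_closed_path N k).
    by rewrite -has_pred1 has_count visits // mem_iota add1n.
  rewrite (perm_mem perm_w) => /mapP [i _ /(congr1 (modn^~ N))].
  rewrite residue_mod => eq1.
  (* Coprimality to [N] depends only on the class modulo [N], and [i * k] is congruent to 1. *)
  have : coprime (i * k) N by rewrite -coprime_modl -eq1 coprime_modl coprime1n.
  by rewrite coprimeMl => /andP [_ /eqP].
have ndvd : ~~ (N %| k).
  by apply: contraL hN => /gcdn_idPr gcdN; rewrite -gcdN (eqP cop).
have uniq_s : uniq [seq residue N (i * k) | i <- iota 1 N].
  by rewrite (map_inj_in_uniq (residue_mul_inj N k cop)) iota_uniq.
have uniq_w : uniq (behead (k_closed_path N k)) by rewrite (perm_uniq perm_w).
split=> [|v vV].
  by split=> //; apply: is_closed_path_k_closed_path.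
rewrite count_uniq_mem // (perm_mem perm_w).
have sub_s : {subset [seq residue N (i * k) | i <- iota 1 N] <= vertices N}.
  by move=> _ /mapP [i _ ->]; apply: residue_mem.
(* Pigeonhole: [N] distinct entries among [N] vertices exhaust them. *)
have [|_ ->] := uniq_min_size uniq_s sub_s; last by rewrite vV.
by rewrite size_map !size_iota.
Qed.
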